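(* Let $\mathcal{S}$ be a non-degenerate thick-lined polar space of rank at least $2$ (possibly of infinite rank), let $a,b$ be opposite points of $\mathcal{S}$ and let $N$ be a generator of the polar space $\{a,b\}^\perp$. If $N^\perp=\langle N\cup\{a,b\}^{\perp\perp}\rangle$, then for every generator $N'$ of $\{a,b\}^\perp$ we have $(N\cup N')^\perp=\langle (N\cap N')\cup\{a,b\}^{\perp\perp}\rangle$.
   Context: Two points $x,y$ are collinear ($x\perp y$) if equal or on a common line. For a set $X$ of points, $X^\perp$ is the set of points collinear with all points of $X$, $X^{\perp\perp}=(X^\perp)^\perp$. Subspaces are sets of points containing every line meeting them in at least two points; singular subspaces are subspaces with pairwise collinear points; $\langle X\rangle$ is the subspace generated by $X$. Opposite points are non-collinear points. For opposite points $a,b$, $\{a,b\}^\perp$ is itself a polar space; its generators are the singular subspaces maximal among the singular subspaces contained in $\{a,b\}^\perp$. *)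

(* Defs.v *)
From mathcomp Require Import all_boot.
From mathcomp Require Import boolp classical_sets.

Set Implicit Arguments.
Unset Strict Implicit.
Unset Printing Implicit Defensive.

Local Open Scope classical_set_scope.

(* A point-line geometry is a type P of points together with a family
   L : set (set P) of lines, each line being the set of its points. *)

Definition collinear (P : Type) (L : set (set P)) (x y : P) : Prop :=
  x = y \/ exists l, [/\ L l, l x & l y].

Definition perp (P : Type) (L : set (set P)) (X : set P) : set P :=
  [set y | forall x, X x -> collinear L x y].

Definition subspace (P : Type) (L : set (set P)) (S : set P) : Prop :=
  forall l x y, L l -> l x -> l y -> x <> y -> S x -> S y -> l `<=` S.

Definition singular_subspace (P : Type) (L : set (set P)) (S : set P) : Prop :=
  subspace L S /\ forall x y, S x -> S y -> collinear L x y.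

Definition generated (P : Type) (L : set (set P)) (X : set P) : set P :=
  smallest (subspace L) X.

(* The second condition is the one-or-all axiom of Buekenhout and Shult.
   Uniqueness of the line through two distinct points is not assumed: it
   follows from non-degeneracy. *)
Definition polar_space (P : Type) (L : set (set P)) : Prop :=
  (forall l, L l -> exists x y, [/\ l x, l y & x <> y]) /\
  (forall p l, L l ->
     (exists! x, l x /\ collinear L p x) \/
     (forall x, l x -> collinear L p x)).

Definition nondegenerate (P : Type) (L : set (set P)) : Prop :=
  perp L [set: P] = set0.

Definition thick_lined (P : Type) (L : set (set P)) : Prop :=
  forall l, L l -> exists x y z,
    [/\ l x, l y & l z] /\ [/\ x <> y, x <> z & y <> z].

(* The rank is the supremum of the lengths n of the chains
   X 0 < X 1 < ... < X n of singular subspaces, the empty subspace being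
   allowed as X 0; points have rank 1 and lines have rank 2.  Stating lower
   bounds only leaves room for infinite rank. *)
Definition rank_ge (P : Type) (L : set (set P)) (n : nat) : Prop :=
  exists X : nat -> set P,
    (forall i, i <= n -> singular_subspace L (X i)) /\
    (forall i, i < n -> X i `<` X i.+1).

Definition opposite (P : Type) (L : set (set P)) (x y : P) : Prop :=
  ~ collinear L x y.

Definition generator_of (P : Type) (L : set (set P)) (A M : set P) : Prop :=
  [/\ singular_subspace L M, M `<=` A &
      forall M', singular_subspace L M' -> M' `<=` A -> M `<=` M' -> M' = M].

(* Main.v *)
Require Import Defs.
From mathcomp Require Import all_boot.
From mathcomp Require Import boolp classical_sets.

Local Open Scope classical_set_scope.

(** By maximality of [N], a point of [perp N] collinear with both [a] and [b]
    lies in [N]; together with the one-or-all axiom this shows that every line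
    inside [perp N] meets [N].  Hence the points of [perp N] that lie in [N] or
    are collinear with some point [h] of the hyperbolic line [H] through [a] and
    [b] ([h] outside [N]) form a subspace, which by hypothesis is all of
    [perp N].  A point [x] of [perp (N `|` N')] outside [N] is therefore equal
    to some such [h], or joined to it by a line meeting [N] in a point [n];
    since [x] and [h] lie in [perp N'], so does [n], and maximality of [N'] puts
    [n] in [N `&` N']. *)

Section PolarSpace.
Set Implicit Arguments.
Unset Strict Implicit.
Unset Printing Implicit Defensive.
Variables (P : Type) (L : set (set P)).
Hypothesis hpolar : polar_space L.

Lemma collinear_sym (x y : P) : collinear L x y -> collinear L y x.
Proof.
by case=> [->|[l [Ll lx ly]]]; [left|right; exists l; split].
Qed.

Lemma collinear_on_line (l : set P) (x y : P) :
  L l -> l x -> l y -> collinear L x y.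
Proof. by move=> Ll lx ly; right; exists l. Qed.

Lemma exists_collinear_on_line (p : P) (l : set P) :
  L l -> exists2 x, l x & collinear L p x.
Proof.
move=> Ll; have [x [y [lx _ _]]] := hpolar.1 _ Ll.
case: (hpolar.2 p _ Ll) => [[u [[lu pu] _]]|all_l]; first by exists u.
by exists x => //; exact: all_l.
Qed.

(** Two distinct points of [l] collinear with [p] rule out the [one] case of the one-or-all
    axiom. *)
Lemma collinear_line (p : P) (l : set P) (x y z : P) :
  L l -> l x -> l y -> x <> y -> collinear L p x -> collinear L p y ->
  l z -> collinear L p z.
Proof.
move=> Ll lx ly xy px py lz; case: (hpolar.2 p _ Ll) => [[u [_ uniq_u]]|]; last exact.
by case: xy; rewrite -(uniq_u x) // -(uniq_u y).
Qed.

Lemma perp_subspace (X : set P) : subspace L (perp L X).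
Proof.
move=> l x y Ll lx ly xy Xx Xy z lz p Xp.
by apply: (@collinear_line p l x y) => //; [exact: Xx|exact: Xy].
Qed.

Lemma sub_perpperp (X : set P) : X `<=` perp L (perp L X).
Proof. by move=> x Xx y yX; apply: collinear_sym; exact: yX. Qed.

Lemma subspaceI (S T : set P) :
  subspace L S -> subspace L T -> subspace L (S `&` T).
Proof.
move=> sS sT l x y Ll lx ly xy [Sx Tx] [Sy Ty] z lz.
by split; [exact: (sS l x y)|exact: (sT l x y)].
Qed.

(** Adding [z] to [M] keeps points pairwise collinear, so a singular subspace of [A] contains both,
    and maximality makes it [M]. *)
Lemma generator_perp (A M : set P) (z : P) :
  subspace L A -> generator_of L A M -> A z -> perp L M z -> M z.
Proof.
move=> sA [[sM cM] MA maxM] Az Mz.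
pose T := M `|` [set z].
have cT x y : T x -> T y -> collinear L x y.
  move=> [Mx|->] [My|->]; [exact: cM|exact: Mz| |by left].
  by apply: collinear_sym; exact: Mz.
(* This intersection is the singular subspace around [T]: its points lie in both [perp L T] and the
   perp of that set, hence are pairwise collinear. *)
have subT : T `<=` (perp L T `&` perp L (perp L T)) `&` A.
  move=> x Tx; split; last by case: Tx => [/MA|->].
  by split; [move=> y Ty; exact: cT|exact: sub_perpperp].
rewrite -(maxM _ _ _ (fun x Mx => subT x (or_introl Mx))).
- by apply: subT; right.
- split; last by move=> x y [[Tx _] _] [[_ TTy] _]; exact: TTy.
  by apply: subspaceI => //; apply: subspaceI; exact: perp_subspace.
- by move=> x [].
Qed.

Lemma line_meets_generator (a b : P) (N l : set P) :
  opposite L a b -> generator_of L (perp L [set a; b]) N ->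
  L l -> l `<=` perp L N -> exists2 n, l n & N n.
Proof.
move=> hab hN Ll lN.
have NabP n : collinear L a n -> collinear L b n -> perp L N n -> N n.
  move=> an bn; apply: (generator_perp (@perp_subspace _) hN).
  by move=> x [->|->].
have Nperp x : [set a; b] x -> perp L N x.
  move=> abx n Nn; have [_ Nab _] := hN.
  by apply: collinear_sym; exact: Nab.
(* On a line inside the perp of [a], any point collinear with [b] is collinear with both. *)
have meets_a k : L k -> k `<=` perp L N -> k `<=` collinear L a ->
    exists2 n, k n & N n.
  move=> Lk kN ka; have [n kn bn] := exists_collinear_on_line b Lk.
  by exists n => //; apply: NabP => //; [exact: ka|exact: kN].
have [r lr ar] := exists_collinear_on_line a Ll.
case: (pselect (a = r)) => [ar'|nar].
  by apply: meets_a => // p lp; rewrite ar'; exact: (collinear_on_line Ll).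
case: ar => // -[k [Lk ka kr]].
have [n kn Nn] : exists2 n, k n & N n.
  apply: meets_a => // [|z kz]; last exact: (collinear_on_line Lk).
  by apply: (@perp_subspace N k a r) => //; [apply: Nperp; left|exact: lN].
have [nr|nr] := pselect (n = r); first by exists n => //; rewrite nr.
(* Each point of [l] is collinear with [n] and [r], hence with all of the line [k], which contains
   [a]. *)
apply: meets_a => // p lp; apply: collinear_sym.
apply: (@collinear_line p k n r) => //; last exact: (collinear_on_line Ll).
by apply: collinear_sym; exact: (lN p lp).
Qed.

Lemma perp_generator_cases (a b : P) (N : set P) (x : P) :
  opposite L a b -> generator_of L (perp L [set a; b]) N ->
  perp L N = generated L (N `|` perp L (perp L [set a; b])) ->
  perp L N x ->
  N x \/ exists h, [/\ perp L (perp L [set a; b]) h, ~ N h & collinear L h x].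
Proof.
move=> hab hN hNperp Nx; set H := perp L (perp L [set a; b]).
have [[sN cN] Nab _] := hN.
pose S := [set y | perp L N y /\
  (N y \/ exists h, [/\ H h, ~ N h & collinear L h y])].
suff : S x by case.
move: (Nx); rewrite hNperp; apply; split; last first.
  move=> y [Ny|Hy].
    by split; [move=> z Nz; exact: cN|left].
  split; first by move=> n Nn; apply: Hy; exact: Nab.
  by have [Ny|nNy] := pselect (N y); [left|right; exists y; split=> //; left].
move=> l y z Ll ly lz yz [Ny Sy] [Nz Sz] w lw.
have lN : l `<=` perp L N by apply: (@perp_subspace N l y z).
split; first exact: lN.
have [m lm Nm] := line_meets_generator hab hN Ll lN.
(* The point [h] attached to [u] is also collinear with [m], so it serves every point of [l]. *)
have extend u : l u -> ~ N u ->
    (N u \/ exists h, [/\ H h, ~ N h & collinear L h u]) ->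
    exists h, [/\ H h, ~ N h & collinear L h w].
  move=> lu nNu [//|[h [Hh nNh hu]]]; exists h; split => //.
  apply: (@collinear_line h l u m) => //; first by move=> um; rewrite um in nNu.
  by apply: collinear_sym; apply: Hh; exact: Nab.
have [Ny'|nNy] := pselect (N y); last by right; exact: (extend y).
have [Nz'|nNz] := pselect (N z); last by right; exact: (extend z).
by left; exact: (sN l y z).
Qed.

End PolarSpace.

Theorem theorem3p2 (P : Type) (L : set (set P))
  (hpolar : polar_space L) (hnondeg : nondegenerate L)
  (hthick : thick_lined L) (hrank : rank_ge L 2)
  (a b : P) (hab : opposite L a b)
  (N : set P) (hN : generator_of L (perp L [set a; b]) N)
  (hNperp : perp L N = generated L (N `|` perp L (perp L [set a; b]))) :
  forall N' : set P, generator_of L (perp L [set a; b]) N' ->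
    perp L (N `|` N') =
    generated L ((N `&` N') `|` perp L (perp L [set a; b])).
Proof.
move=> N' hN'; have [[_ cN] Nab _] := hN; have [[_ cN'] N'ab _] := hN'.
have N'P n : N n -> perp L N' n -> N' n.
  by move=> /Nab; apply: (generator_perp hpolar (perp_subspace hpolar (X := _)) hN').
have HN' h : perp L (perp L [set a; b]) h -> perp L N' h.
  by move=> Hh n N'n; apply: Hh; exact: N'ab.
apply/seteqP; split => [x xNN'|]; last first.
  apply: smallest_sub; first exact: perp_subspace.
  move=> y [[Ny N'y] n [Nn|N'n]|Hy n [Nn|N'n]].
  - exact: cN.
  - exact: cN'.
  - by apply: Hy; exact: Nab.
  - by apply: Hy; exact: N'ab.
have Nx : perp L N x by move=> n Nn; apply: xNN'; left.
have N'x : perp L N' x by move=> n N'n; apply: xNN'; right.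
move=> S [sS subS].
have [Nx'|[h [Hh nNh hx]]] := perp_generator_cases hpolar hab hN hNperp Nx.
  by apply: subS; left; split => //; exact: N'P.
have [->|nhx] := pselect (x = h); first by apply: subS; right.
case: hx => [hx|[k [Lk kh kx]]]; first by case: nhx.
have kN : k `<=` perp L N.
  by apply: (perp_subspace hpolar Lk kx kh nhx) => // n /Nab; exact: Hh.
have kN' : k `<=` perp L N'.
  by apply: (perp_subspace hpolar Lk kx kh nhx) => //; exact: HN'.
have [n kn Nn] := line_meets_generator hpolar hab hN Lk kN.
(* As [h] is outside [N], it differs from [n]; these two points of [S] force the line [k], and with
   it [x], into [S]. *)
apply: (sS k h n Lk kh kn) => //; first by move=> hn; rewrite hn in nNh.
  by apply: subS; right.
by apply: subS; left; split => //; apply: N'P => //; exact: kN'.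
Qed.
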